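(* Let $T:S^1\to S^1$ be a Denjoy counter-example with non-wandering set $\Lambda$. Then the flow $\mathcal{X}=(S^1,T)$ is MMA, but the flow $\mathcal{A}=(\Lambda,T)$ is not equicontinuous. However, the flow $\mathcal{A}=(\Lambda,T)$ is MLS; thus the flow $\mathcal{X}=(S^1,T)$ is MMA and MMLS.
   Context: $S^1$ is the unit circle with its usual (arc length) metric. A Denjoy counter-example is an orientation-preserving homeomorphism $T:S^1\to S^1$ with irrational rotation number $\rho$ such that for every $z\in S^1$ the $\omega$-limit set $\omega(z)$ is a Cantor set $\Lambda$ (independent of $z$); equivalently, $T$ is semi-conjugate, via a continuous onto but not injective map, to the rotation $R_\rho(z)=e^{2\pi i\rho}z$ with $\rho$ irrational, but not conjugate to it. The set $\Lambda$ is called the non-wandering set of $T$; it is $T$-invariant and $T:\Lambda\to\Lambda$ is minimal. A flow $(X,T)$ is a compact metric space $(X,d)$ with a continuous map $T:X\to X$. It is equicontinuous if the family $\{T^n\}_{n\ge0}$ is equicontinuous: for every $\epsilon>0$ there is $\delta>0$ such that $d(x,y)<\delta$ implies $d(T^nx,T^ny)<\epsilon$ for all $n\ge0$. A minimal subset $K\subseteq X$ is a non-empty closed subset with $T(K)\subseteq K$ such that $T:K\to K$ is minimal (every forward orbit in $K$ is dense in $K$). The upper density of $E\subseteq\mathbb{N}$ is $\overline{D}(E)=\limsup_{n\to\infty}\frac{\#(E\cap[1,n])}{n}$. A flow is mean-L-stable (MLS) if for every $\epsilon>0$ there is $\delta>0$ such that $d(x,y)<\delta$ implies $d(T^nx,T^ny)<\epsilon$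 for all $n=0,1,2,\dots$ except for a set of natural numbers of upper density less than $\epsilon$. A flow $(X,T)$ is minimally mean-L-stable (MMLS) if for every minimal subset $K\subseteq X$ the sub-flow $(K,T)$ is MLS. Given a minimal subset $K$, a point $x\in X$ is mean attracted to $K$ if for every $\epsilon>0$ there is $z=z_{\epsilon,x}\in K$ with $\limsup_{N\to\infty}\frac1N\sum_{n=1}^N d(T^nx,T^nz)<\epsilon$; $\mathrm{Basin}(K)$ is the set of all points mean attracted to $K$. A flow is minimally mean attractable (MMA) if $X=\bigcup_K \mathrm{Basin}(K)$, where $K$ ranges over all minimal subsets of $X$. *)

(* Defs.v *)
From HB Require Import structures.
From mathcomp Require Import all_boot all_order all_algebra.
From mathcomp Require Import complex.
From mathcomp Require Import all_classical all_reals all_analysis.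
From mathcomp Require Import ring lra.

Set Implicit Arguments.
Unset Strict Implicit.
Unset Printing Implicit Defensive.

Import Order.TTheory GRing.Theory Num.Theory.
Import numFieldNormedType.Exports.

Local Open Scope classical_set_scope.
Local Open Scope ring_scope.

(* A flow [(phase, step)] whose phase space is a compact subset of an ambient
   metric space, with the restricted distance; a flow on the whole space has
   [phase = setT]. The values of [step] outside [phase] are irrelevant: every
   notion below only looks at points of [phase] and their forward orbits. *)
Record flow (R : realType) (X : metricType R) := Flow {
  phase : set X;
  step : X -> X;
  flow_compact : compact phase;
  flow_continuous : {within phase, continuous step};
  flow_stable : forall x, phase x -> phase (step x) }.

Section flows.
Context {R : realType} {X : metricType R}.
Implicit Types (F : flow X) (K : set X).

Definition flow_iter F (n : nat) (x : X) : X := iter n (step F) x.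

Definition equicontinuous_flow F : Prop :=
  forall eps : R, 0 < eps -> exists2 delta : R, 0 < delta &
    forall x y, phase F x -> phase F y -> mdist x y < delta ->
      forall n, mdist (flow_iter F n x) (flow_iter F n y) < eps.

Record minimal_subset F K : Prop := MinimalSubset {
  minimal_nonempty : K !=set0;
  minimal_closed : closed K;
  minimal_sub : K `<=` phase F;
  minimal_stable : forall x, K x -> K (step F x);
  minimal_dense : forall x, K x -> K `<=` closure (range (flow_iter F ^~ x)) }.

Lemma minimal_compact F K : minimal_subset F K -> compact K.
Proof.
move=> [_ Kc KF _ _]; exact: subclosed_compact Kc (flow_compact (f := F)) KF.
Qed.

Lemma minimal_continuous F K :
  minimal_subset F K -> {within K, continuous (step F)}.
Proof.
move=> [_ _ KF _ _]; exact: continuous_subspaceW KF (flow_continuous (f := F)).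
Qed.

Definition subflow F K (mK : minimal_subset F K) : flow X :=
  Flow (minimal_compact mK) (minimal_continuous mK) (minimal_stable mK).

Definition upper_density (E : set nat) : \bar R :=
  limn_esup (fun n => ((\sum_(1 <= k < n.+1 | k \in E) 1)%N%:R / n%:R)%:E).

(* mean-L-stable *)
Definition MLS F : Prop :=
  forall eps : R, 0 < eps -> exists2 delta : R, 0 < delta &
    forall x y, phase F x -> phase F y -> mdist x y < delta ->
      exists2 E : set nat, (upper_density E < eps%:E)%E &
        forall n, ~ E n -> mdist (flow_iter F n x) (flow_iter F n y) < eps.

(* minimally mean-L-stable *)
Definition MMLS F : Prop :=
  forall K (mK : minimal_subset F K), MLS (subflow mK).

Definition mean_attracted F K (x : X) : Prop :=
  forall eps : R, 0 < eps -> exists2 z, K z &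
    (limn_esup (fun N => (N%:R^-1 *
       \sum_(1 <= n < N.+1) mdist (flow_iter F n x) (flow_iter F n z))%:E) < eps%:E)%E.

Definition basin F K : set X :=
  [set x | phase F x /\ mean_attracted F K x].

(* minimally mean attractable *)
Definition MMA F : Prop :=
  phase F = \bigcup_(K in minimal_subset F) basin F K.

Definition omega_limit (T : X -> X) (z : X) : set X :=
  cluster ((fun n => iter n T z) @ \oo).

Definition homeomorphism (T : X -> X) : Prop :=
  continuous T /\
  exists S : X -> X, [/\ continuous S, cancel T S & cancel S T].

Definition cantor_set (A : set X) : Prop :=
  [/\ A !=set0, compact A, perfect_set A & totally_disconnected A].

End flows.

Record circle (R : realType) := Circle {
  circle_val :> R[i];
  circleP : `|circle_val| == 1 }.

HB.instance Definition _ (R : realType) := [isSub for @circle_val R].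
HB.instance Definition _ (R : realType) := [Choice of circle R by <:].

Section circle_metric.
Context {R : realType}.
Implicit Types x y z : circle R.

(* [Re (x * y^* )] is the cosine of the angle between the unit vectors x, y. *)
Definition arc_dist x y : R :=
  acos (complex.Re ((x : R[i]) * conjc (y : R[i]))).

Lemma circle_eqn x :
  complex.Re (x : R[i]) ^+ 2 + complex.Im (x : R[i]) ^+ 2 = 1.
Proof.
case: x => [[a b]] /= /eqP; rewrite normc_def /= => -[h].
by rewrite -[LHS]sqr_sqrtr ?addr_ge0 ?sqr_ge0// h expr1n.
Qed.

Lemma circle_inner x y : complex.Re ((x : R[i]) * conjc (y : R[i])) =
  complex.Re (x : R[i]) * complex.Re (y : R[i]) +
  complex.Im (x : R[i]) * complex.Im (y : R[i]).
Proof. by case: x y => [[a b] ?] [[c d] ?] /=; ring. Qed.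

Lemma lagrange2 (a b c d : R) : a ^+ 2 + b ^+ 2 = 1 -> c ^+ 2 + d ^+ 2 = 1 ->
  1 - (a * c + b * d) ^+ 2 = (a * d - b * c) ^+ 2.
Proof.
move=> h1 h2; rewrite -[1 in LHS](mul1r 1) -{1}h1 -h2; ring.
Qed.

Lemma inner_itv (a b c d : R) : a ^+ 2 + b ^+ 2 = 1 -> c ^+ 2 + d ^+ 2 = 1 ->
  -1 <= a * c + b * d <= 1.
Proof.
move=> h1 h2; have := lagrange2 h1 h2; have := sqr_ge0 (a * d - b * c).
move: (_ + _) => s h3 h4; apply/andP; split; nra.
Qed.

Lemma arc_distxx x : arc_dist x x = 0.
Proof. by rewrite /arc_dist circle_inner -!expr2 circle_eqn acos1. Qed.

Lemma arc_dist_sym x y : arc_dist x y = arc_dist y x.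
Proof.
by rewrite /arc_dist !circle_inner [X in X + _]mulrC [X in _ + X]mulrC.
Qed.

Lemma arc_dist_positivity x y : arc_dist x y = 0 -> x = y.
Proof.
rewrite /arc_dist circle_inner; move: (circle_eqn x) (circle_eqn y).
case: x y => [[a b] ?] [[c d] ?] /= h1 h2 h; apply: val_inj => /=.
have := congr1 cos h; rewrite acosK ?in_itv/= ?inner_itv// cos0 => h3.
have h4 : (a - c) ^+ 2 + (b - d) ^+ 2 = 0 by nra.
have /eqP := h4; rewrite paddr_eq0 ?sqr_ge0// !sqrf_eq0 !subr_eq0.
by move=> /andP[/eqP -> /eqP ->].
Qed.

Lemma arc_dist_triangle y x z :
  arc_dist x z <= arc_dist x y + arc_dist y z.
Proof.
rewrite /arc_dist !circle_inner.
move: (circle_eqn x) (circle_eqn y) (circle_eqn z).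
case: x y z => [[a b] ?] [[c d] ?] [[e f] ?] /= h1 h2 h3.
have i12 := inner_itv h1 h2; have i23 := inner_itv h2 h3.
have i13 := inner_itv h1 h3.
set p := a * c + b * d in i12 *; set q := c * e + d * f in i23 *.
set r := a * e + b * f in i13 *.
have [pi_le|lt_pi] := leP pi (acos p + acos q).
  exact: le_trans (acos_lepi i13) pi_le.
rewrite leNgt; apply/negP => h.
have : cos (acos r) < cos (acos p + acos q).
  rewrite ltr_cos// in_itv/= ?acos_ge0 ?acos_lepi//=.
  by rewrite addr_ge0 ?acos_ge0//= ltW.
rewrite cosD !acosK ?in_itv//= !sin_acos// (lagrange2 h1 h2) (lagrange2 h2 h3).
rewrite !sqrtr_sqr -normrM => h4.
have h5 : r - p * q = (a * d - b * c) * (d * e - c * f).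
  by rewrite -[r]mulr1 -h2 /r /p /q; ring.
have := ler_norm ((a * d - b * c) * (c * f - d * e)).
by move: (`|_|) h4 => N; lra.
Qed.

End circle_metric.

HB.instance Definition _ (R : realType) := @isMetric.Build R (circle R)
  arc_dist arc_distxx arc_dist_positivity arc_dist_sym arc_dist_triangle.

Section circle_maps.
Context {R : realType}.
Implicit Types (T : circle R -> circle R) (L : set (circle R)).

Lemma cis_norm (t : R) :
  `|(cos (2 * pi * t) +i* sin (2 * pi * t))%C| == 1 :> R[i].
Proof. by rewrite normc_def /= cos2Dsin2 sqrtr1. Qed.

(* [t |-> exp (2 i pi t)], the universal covering of the circle *)
Definition cis (t : R) : circle R := Circle (cis_norm t).

(* A circle homeomorphism preserves orientation iff it has a lift to the line
   that is increasing and commutes with the unit translation. *)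
Definition increasing_lift T (F : R -> R) : Prop :=
  [/\ continuous F, {homo F : s t / s < t},
      (forall t, F (t + 1) = F t + 1) & (forall t, T (cis t) = cis (F t))].

Definition orientation_preserving T : Prop := exists F, increasing_lift T F.

(* The rotation number is defined modulo 1: [rho] is any representative. *)
Definition rotation_number T (rho : R) : Prop :=
  exists2 F, increasing_lift T F &
    forall t, (fun n => (iter n F t - t) / n%:R) @ \oo --> rho.

(* [L], the common omega-limit set of all points, is the set called the
   non-wandering set of [T]. *)
Record denjoy_counterexample T L : Prop := DenjoyCounterexample {
  denjoy_homeo : homeomorphism T;
  denjoy_orientation : orientation_preserving T;
  denjoy_rotation : exists2 rho, rotation_number T rho & irrational rho;
  denjoy_cantor : cantor_set L;
  denjoy_omega : forall z, omega_limit T z = L }.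

Lemma cis_arc (s t : R) : `|s - t| <= 2^-1 ->
  mdist (cis s) (cis t) = 2 * pi * `|s - t|.
Proof.
move=> st; have pi0 := pi_gt0 R.
have -> : mdist (cis s) (cis t) = arc_dist (cis s) (cis t) by [].
rewrite /arc_dist circle_inner /= -cosB -mulrBr.
have [st0|st0] := leP 0 (s - t).
  rewrite cosK ?ger0_norm// in_itv/=; move: st; rewrite ger0_norm// => st.
  by apply/andP; split; nra.
move: st; rewrite ltr0_norm// => st; rewrite cosKN ?mulrN//.
by apply/andP; split; nra.
Qed.

Lemma cis_continuous : continuous cis.
Proof.
move=> t; apply/metricType_numDomainType.cvgrPdist_lt => e e0; have pi0 := pi_gt0 R.
near=> s; rewrite cis_arc.
  rewrite -ltr_pdivlMl ?mulr_gt0//; near: s.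
  by apply: cvgr_dist_lt; rewrite ?mulr_gt0// invr_gt0 mulr_gt0.
by near: s; apply: cvgr_dist_le.
Unshelve. all: by end_near. Qed.

Lemma cis_surj (z : circle R) : exists2 t, t \in `[0, 1] & cis t = z.
Proof.
have pi0 := pi_gt0 R.
have := circle_eqn z; case: z => [[a b] zP] /= h.
have ab : -1 <= a <= 1 by apply/andP; split; nra.
have a0 := acos_ge0 ab; have api := acos_lepi ab.
have pi20 : 2 * pi != 0 :> R by rewrite mulf_neq0 ?gt_eqF.
have sE : Num.sqrt (1 - a ^+ 2) = `|b| by rewrite -h addrAC subrr add0r sqrtr_sqr.
have q0 : 0 <= acos a / (2 * pi) by rewrite divr_ge0// mulr_ge0// ltW.
have q1 : acos a / (2 * pi) <= 1 by rewrite ler_pdivrMr ?mulr_gt0//; lra.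
have [b0|b0] := leP 0 b.
  exists (acos a / (2 * pi)); first by rewrite in_itv/= q0.
  apply: val_inj => /=; rewrite [2 * pi * _]mulrC divfK// acosK ?in_itv//.
  by rewrite sin_acos// sE ger0_norm.
exists (1 - acos a / (2 * pi)).
  by rewrite in_itv/=; apply/andP; split; lra.
have E : 2 * pi * (1 - acos a / (2 * pi)) = - acos a + pi *+ 2.
  by rewrite mulrBr mulr1 [2 * pi * (_ / _)]mulrC divfK// addrC mulr_natl.
apply: val_inj => /=; rewrite E (cosD (- _)) (sinD (- _)) cosN sinN cos2pi sin2pi.
rewrite acosK ?in_itv// sin_acos// sE ltr0_norm//.
by rewrite !mulr0 !mulr1 subr0 addr0 opprK.
Qed.

Lemma circle_compact : compact [set: circle R].
Proof.
have -> : [set: circle R] = cis @` `[0, 1]%classic.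
  by apply/seteqP; split => // z _; have [t tI <-] := cis_surj z; exists t.
apply: continuous_compact; last exact: segment_compact.
exact/continuous_subspaceT/cis_continuous.
Qed.

Lemma homeomorphism_within T (A : set (circle R)) :
  homeomorphism T -> {within A, continuous T}.
Proof. by move=> [Tc _]; exact: continuous_subspaceT. Qed.

Definition circle_flow T (hT : homeomorphism T) : flow (circle R) :=
  Flow circle_compact (homeomorphism_within hT) (fun _ _ => I).

Lemma denjoy_stable T L : denjoy_counterexample T L ->
  forall z, L z -> L (T z).
Proof.
move=> [[Tc _] _ _ _ TL] z; rewrite -(TL (cis 0)) => zL A B AT /Tc TB.
have [|w [/= Aw Bw]] := zL (T @^-1` A) (T @^-1` B) _ TB; last by exists (T w).
case: AT => N _ NA; exists N => // n /= Nn.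
by apply: (NA n.+1) => /=; exact: leqW.
Qed.

Lemma denjoy_compact T L : denjoy_counterexample T L -> compact L.
Proof. by case=> _ _ _ []. Qed.

Definition denjoy_flow T L (hT : denjoy_counterexample T L) :
    flow (circle R) :=
  Flow (denjoy_compact hT) (homeomorphism_within (denjoy_homeo hT))
    (denjoy_stable hT).

End circle_maps.

(* Main.v *)
Require Import Defs.
From mathcomp Require Import all_boot all_order all_algebra.
From mathcomp Require Import all_classical all_reals all_analysis.
From mathcomp Require Import ring lra zify.

Set Implicit Arguments.
Unset Strict Implicit.
Unset Printing Implicit Defensive.

Import Order.TTheory GRing.Theory Num.Theory.
Import numFieldNormedType.Exports.

Local Open Scope classical_set_scope.
Local Open Scope ring_scope.

(** Let [F] be a lift of [T] to the line. As the rotation number is irrational,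
    no iterate [F^m] with [m > 0] maps a point to one of its integer
    translates. Everything follows from this and from the remark that disjoint
    arcs of the circle have bounded total length.

    Mean stability. Given [q], the displacements of [F], ..., [F^(q-1)] are
    bounded away from the integers, by compactness. Hence a sufficiently short
    arc is disjoint from its first [q - 1] iterates, and any [q] consecutive
    iterates of it are pairwise disjoint: their total length is bounded, so that
    the mean length of the iterates is [O(1 / q)]
    ([short_arc_block], [short_arc_sum]). Orbits of close points of the whole
    circle are therefore close in the mean ([circle_mean_equicontinuous]). By
    Markov's inequality every subflow is mean-L-stable. Moreover the orbit of
    any point comes close to the limit set [L], which is stable under the
    inverse of [T], and from that time on it stays close in the mean to an orbit
    in [L] ([denjoy_attracted]).

    Lack of equicontinuity. As [L] is totally disconnected it has a gap. The
    backward iterates of the gap are pairwise disjoint, so their lengths tend to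
    zero, while their endpoints, which lie in [L], are brought back by the
    forward iterates to a fixed positive distance
    ([denjoy_not_equicontinuous]). *)

(** * Packing disjoint arcs *)

(** Induction on the number of intervals: those other than the one with the
    largest left endpoint lie to the left of that endpoint. *)
Lemma interval_packing (R : realType) (I : finType) (A : {set I})
    (a b : I -> R) (lo hi : R) :
  lo <= hi ->
  {in A, forall i, [/\ lo <= a i, a i < b i & b i <= hi]} ->
  {in A &, forall i j, i != j -> b i <= a j \/ b j <= a i} ->
  \sum_(i in A) (b i - a i) <= hi - lo.
Proof.
move: {2}#|A| (erefl #|A|) => n; elim: n A hi => [|n IH] A hi.
  by move=> /eqP; rewrite cards_eq0 => /eqP -> ? _ _; rewrite big_set0 subr_ge0.
move=> cA lohi bnd dis.
have [i0 i0A] : exists i, i \in A by apply/card_gt0P; rewrite cA.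
have [i iA imax] := @arg_maxP _ _ _ i0 (mem A) a i0A.
have [loi abi bhi] := bnd i iA.
rewrite (big_setD1 i)//=.
suff : \sum_(j in A :\ i) (b j - a j) <= a i - lo by lra.
apply: IH => //.
- by have := cardsD1 i A; rewrite (iA : i \in A) cA add1n => -[->].
- move=> j /setD1P[ji jA]; have [? abj _] := bnd j jA; split=> //.
  by have [//|bij] := dis j i jA iA ji; have := imax j jA => /= ?; lra.
- by move=> j k /setD1P[_ jA] /setD1P[_ kA]; exact: dis.
Qed.

(** The intervals are lifts of arcs that do not overlap on the circle. Moving
    the left endpoints into [0, 1[ by integer translations gives intervals
    inside [0, 2] that do not overlap. *)
Lemma arc_packing (R : realType) (n : nat) (a b : nat -> R) :
  (forall i, (i < n)%N -> a i < b i <= a i + 1) ->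
  (forall i j, (i < j < n)%N -> forall k : int,
     b j + k%:~R <= a i \/ b i <= a j + k%:~R) ->
  \sum_(i < n) (b i - a i) <= 2.
Proof.
move=> ab dis.
pose fl (i : 'I_n) : R := (Num.floor (a i))%:~R.
rewrite (eq_bigr (fun i : 'I_n => (b i - fl i) - (a i - fl i))); last first.
  by move=> i _; lra.
rewrite -[leRHS]subr0 (eq_bigl [in [set: 'I_n]%SET]); last by move=> i; rewrite !inE.
apply: interval_packing => [//|i _|i j _ _].
  have /andP[? ?] := ab i (ltn_ord i).
  have := floor_le (a i); have := floorD1_gt (a i); rewrite intrD -/(fl i).
  by move=> ? ?; split; lra.
have H (i' j' : 'I_n) : (i' < j')%N ->
    b j' - fl j' <= a i' - fl i' \/ b i' - fl i' <= a j' - fl j'.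
  move=> lij; have lijn : (i' < j' < n)%N by rewrite lij ltn_ord.
  have := dis _ _ lijn (Num.floor (a i') - Num.floor (a j')).
  by rewrite intrB -/(fl i') -/(fl j') => -[?|?]; [left|right]; lra.
rewrite neq_ltn => /orP[/H|/H] []; by [left|right].
Qed.

(** * Lifts of degree one without periodic points *)

Section degree_one_lift.
Context {R : realType} (F : R -> R).
Hypotheses (Fc : continuous F) (Fi : {homo F : s t / s < t})
  (F1 : forall t, F (t + 1) = F t + 1).

Lemma iter_lift_continuous n : continuous (iter n F).
Proof.
elim: n => [|n IH] t; first exact: cvg_id.
exact: (@continuous_comp _ _ _ (iter n F) F t (IH t) (@Fc _)).
Qed.

Lemma iter_lift_mono n : {mono iter n F : s t / s <= t}.
Proof. by apply: le_mono; elim: n => //= n IH s t st; exact/Fi/IH. Qed.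

Lemma iter_lift_int n t (k : int) : iter n F (t + k%:~R) = iter n F t + k%:~R.
Proof.
have Fnat (m : nat) s : F (s + m%:R) = F s + m%:R.
  by elim: m s => [|m IH] s; rewrite ?addr0// -natr1 addrA F1 IH addrA.
have Fint s : F (s + k%:~R) = F s + k%:~R.
  case: k => m; first exact: Fnat.
  rewrite NegzE mulrNz -[X in _ = F X - _](subrK (m.+1%:R : R) s).
  by rewrite Fnat addrK.
by elim: n t => //= n IH t; rewrite IH Fint.
Qed.

(** A periodic orbit [F^m t = t + k] makes [F^(m n) t - t = n k], so that the
    rotation number is the rational [k / m]. *)
Lemma irrational_no_periodic rho :
  (forall t, (fun n => (iter n F t - t) / n%:R) @ \oo --> rho) ->
  irrational rho ->
  forall m t (k : int), (0 < m)%N -> iter m F t <> t + k%:~R.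
Proof.
move=> Frho irr m t k m0 per; apply: irr.
exists (k%:~R / m%:R); first by [].
have iterM n : iter (n * m) F t = t + (k * n%:Z)%:~R.
  elim: n => [|n IH]; first by rewrite mulr0 addr0.
  rewrite mulSn iterD IH iter_lift_int per -addrA -intrD; congr (_ + _%:~R).
  lia.
have sub : (fun n => (iter (n * m) F t - t) / (n * m)%:R) @ \oo --> rho.
  apply: (@cvg_comp _ _ _ (muln^~ m) _ _ \oo _ _ (Frho t)).
  move=> A [N _ NA]; exists N => // n /= Nn; apply: NA => /=.
  exact: leq_trans Nn (leq_pmulr _ m0).
rewrite [LHS]fmorph_div/= ratr_int ratr_nat.
apply: (@cvg_unique _ (@Rhausdorff R) _ _ _ _ _ sub).
apply: cvg_near_cst; exists 1%N => // n /= n0.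
rewrite iterM addrC addKr intrM natrM -[n%:Z%:~R]/(n%:R); field.
by rewrite !pnatr_eq0 -!lt0n m0.
Qed.

Hypothesis aper : forall m t (k : int), (0 < m)%N -> iter m F t <> t + k%:~R.

(** The displacement [F^m - id] is continuous, 1-periodic and avoids the
    integers: its range is a compact interval lying between two consecutive
    integers. *)
Lemma displacement_gap m : (0 < m)%N -> exists2 d : R, 0 < d &
  forall k : int, (forall u, d <= iter m F u - u - k%:~R) \/
                  (forall u, iter m F u - u - k%:~R <= - d).
Proof.
move=> m0; pose g u := iter m F u - u.
have gc : continuous g.
  by move=> u; apply: cvgB; [exact: iter_lift_continuous|exact: cvg_id].
have gcw A : {within A, continuous g} by exact: continuous_subspaceT.
have gI u (k : int) : g u <> k%:~R.
  by move=> E; apply: (@aper m u k m0); rewrite -E /g addrC subrK.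
have gper u : g (u - (Num.floor u)%:~R) = g u.
  by rewrite /g -mulrNz iter_lift_int; lra.
have ufl (u : R) : u - (Num.floor u)%:~R \in `[0, 1].
  have := floor_le u; have := floorD1_gt u; rewrite intrD in_itv/= => ? ?.
  by apply/andP; split; lra.
pose k0 := Num.floor (g 0).
have k0g : k0%:~R < g 0.
  by rewrite lt_neqAle floor_le andbT; apply/eqP => /esym; exact: gI.
have gk0 : g 0 < k0%:~R + 1 by have := floorD1_gt (g 0); rewrite intrD.
have k0I u : u \in `[0, 1] -> k0%:~R < g u < k0%:~R + 1.
  rewrite in_itv/= => /andP[u0 _].
  apply/andP; split; rewrite ltNge; apply/negP => h.
    have [|c _] := @IVT R g 0 u k0%:~R u0 (gcw _); last exact: gI.
    by rewrite ge_min le_max h (ltW k0g) orbT.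
  have [|c _] := @IVT R g 0 u (k0 + 1)%:~R u0 (gcw _); last exact: gI.
  by rewrite intrD ge_min le_max h (ltW gk0) orbT.
have [c cI cmax] := @EVT_max R g 0 1 ler01 (gcw _).
have [c' cI' cmin] := @EVT_min R g 0 1 ler01 (gcw _).
have /andP[_ cM] := k0I _ cI; have /andP[cm _] := k0I _ cI'.
exists (Num.min (g c' - k0%:~R) (k0%:~R + 1 - g c)).
  by rewrite lt_min !subr_gt0 cM cm.
move=> k; have [kk0|kk0] := leP k k0; [left|right] => u; rewrite -/(g u) -(gper u).
  have := cmin _ (ufl u); have : k%:~R <= k0%:~R :> R by rewrite ler_int.
  by move=> ? ?; rewrite ge_min; apply/orP; left; lra.
have := cmax _ (ufl u).
have : (k0 + 1)%:~R <= k%:~R :> R by rewrite ler_int lezD1.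
rewrite intrD => ? ?; rewrite lerNr ge_min; apply/orP; right; lra.
Qed.

Lemma displacement_gap_uniform q : exists2 d : R, 0 < d &
  forall m, (0 < m < q)%N -> forall k : int,
    (forall u, d <= iter m F u - u - k%:~R) \/
    (forall u, iter m F u - u - k%:~R <= - d).
Proof.
elim: q => [|[|q] [d d0 IH]]; first by exists 1 => // m; rewrite ltn0 andbF.
  by exists 1 => // -[|m].
have [//|d' d'0 gap] := @displacement_gap q.+1.
exists (Num.min d d'); first by rewrite lt_min d0.
move=> m /andP[m0]; rewrite ltnS leq_eqVlt => /predU1P[->|mq] k.
- have [H|H] := gap k; [left|right] => u; have := H u.
    by apply: le_trans; rewrite ge_min lexx orbT.
  by move=> /le_trans; apply; rewrite lerN2 ge_min lexx orbT.
- have [|H|H] := IH m _ k; [by rewrite m0|left|right] => u; have := H u.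
    by apply: le_trans; rewrite ge_min lexx.
  by move=> /le_trans; apply; rewrite lerN2 ge_min lexx.
Qed.

(** An arc shorter than every displacement [F^m - id] modulo 1 with [0 < m < q]
    is disjoint from its first [q - 1] iterates; the first [q] iterates of such
    an arc are then pairwise disjoint on the circle. *)
Lemma short_arc_block q : exists2 d : R, 0 < d &
  forall s t, s < t < s + d -> t <= s + 1 -> forall n,
    \sum_(i < q) (iter (n + i) F t - iter (n + i) F s) <= 2.
Proof.
have [d d0 gap] := displacement_gap_uniform q.
exists d => // s t /andP[st std] ts1 n.
apply: (@arc_packing R q (fun i => iter (n + i) F s) (fun i => iter (n + i) F t)).
  move=> i _; rewrite (leW_mono (@iter_lift_mono _)) st/=.
  by rewrite -(iter_lift_int _ s 1) iter_lift_mono.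
move=> i j /andP[ij jq] k; rewrite -(subnKC (ltnW ij)) !addnA.
(* cancelling [F^(n + i)], which is increasing, reduces the claim to the arc and its iterate of
   order [j - i] *)
rewrite 2![iter (n + i + _) F _]iterD -2!iter_lift_int !iter_lift_mono.
have [|H|H] := gap (j - i)%N _ (- k).
- by rewrite subn_gt0 ij/= (leq_ltn_trans (leq_subr _ _)).
- by right; have := H s; rewrite mulrNz; lra.
- by left; have := H t; rewrite mulrNz; lra.
Qed.

(** Cutting the sum into blocks of length [q] with [2 / q < eta]; the incomplete
    last block accounts for the constant. *)
Lemma short_arc_sum (eta : R) : 0 < eta -> exists2 d : R, 0 < d &
  forall s t, s < t < s + d -> t <= s + 1 -> forall N,
    \sum_(i < N) (iter i F t - iter i F s) <= 2 + eta * N%:R.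
Proof.
move=> eta0; pose q := (Num.truncn (2 / eta)).+1.
have [d d0 blk] := short_arc_block q.
exists d => // s t st ts1 N.
pose f i := iter i F t - iter i F s.
have f0 i : 0 <= f i.
  by rewrite subr_ge0 iter_lift_mono; case/andP: st => /ltW.
have sumM M : \sum_(i < M * q) f i <= 2 * M%:R.
  elim: M => [|M IH]; first by rewrite big_ord0 mulr0.
  rewrite mulSn addnC big_split_ord/=; have := blk s t st ts1 (M * q)%N.
  by move=> h; rewrite -[M.+1%:R]natr1 mulrDr mulr1 lerD.
have q2 : 2 < eta * q%:R by rewrite mulrC -ltr_pdivrMr// truncnS_gt.
have Nq : (N <= (N %/ q).+1 * q)%N by rewrite ltnW// ltn_ceil.
have -> : 2 + eta * N%:R = eta * N%:R + 2 by rewrite addrC.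
apply: (@le_trans _ _ (2 * ((N %/ q).+1)%:R)); last first.
  rewrite -[(_ %/ q).+1%:R]natr1 mulrDr mulr1 lerD2r.
  have := leq_divM N q; rewrite -(ler_nat R) natrM.
  by have : 0 <= (N %/ q)%:R :> R by []; nra.
apply: le_trans (sumM _); rewrite -(subnKC Nq) big_split_ord/= lerDl.
by rewrite sumr_ge0.
Qed.

End degree_one_lift.

(** * Averages of distances along orbits *)

(** The additive constant [C] absorbs incomplete blocks and finite numbers of
    initial terms; it disappears from the averages. *)
Definition mean_equicontinuous (R : realType) (X : metricType R) (T : X -> X) :=
  forall eta : R, 0 < eta -> exists C, exists2 d : R, 0 < d &
    forall x y, mdist x y < d -> forall N,
      \sum_(i < N) mdist (iter i T x) (iter i T y) <= C + eta * N%:R.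

Lemma limn_esup_div_le (R : realType) (f : nat -> R) (C eta : R) :
  (forall N, f N <= C + eta * N%:R) ->
  (limn_esup (fun N => (f N / N%:R)%:E) <= eta%:E)%E.
Proof.
move=> fle; apply/lee_addgt0Pr => e e0; rewrite -EFinD.
pose N0 := (Num.truncn (C / e)).+1.
apply: (@le_trans _ _
    (ereal_sup ((fun N => (f N / N%:R)%:E) @` [set N | (N0 <= N)%N]))).
  by apply: ereal_inf_lbound => /=; exists [set N | (N0 <= N)%N] => //; exists N0.
apply: ge_ereal_sup => _ [N /= N0N <-].
have N_gt0 : 0 < N%:R :> R by rewrite ltr0n (leq_trans _ N0N).
rewrite lee_fin ler_pdivrMr//; apply: le_trans (fle N) _.
have CeN : C / e < N%:R.
  by apply: lt_le_trans (truncnS_gt _) _; rewrite ler_nat.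
by rewrite mulrDl addrC lerD2l mulrC -ler_pdivrMr// ltW.
Qed.

Lemma ler_sum_from1 (R : realType) (u : nat -> R) N : (forall i, 0 <= u i) ->
  \sum_(1 <= i < N.+1) u i <= \sum_(i < N.+1) u i.
Proof. by move=> u0; rewrite -(big_mkord xpredT) [leRHS]big_ltn// lerDr. Qed.

Section mean_equicontinuous_flows.
Context {R : realType} {X : metricType R}.
Implicit Types (F : flow X) (K : set X).

(** Markov's inequality: the orbits are [eps]-apart with frequency at most
    [1 / eps] times their mean distance. *)
Lemma mean_equicontinuous_MLS F : mean_equicontinuous (step F) -> MLS F.
Proof.
move=> TM eps eps0; have eta0 : 0 < eps ^+ 2 / 2 by rewrite divr_gt0// exprn_gt0.
have [C [d d0 bound]] := TM _ eta0.
exists d => // x y _ _ xyd; pose u n := mdist (iter n (step F) x) (iter n (step F) y).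
have u0 n : 0 <= u n by exact: mdist_ge0.
exists [set n | eps <= u n]; last by move=> n /negP; rewrite -ltNge.
apply: (@le_lt_trans _ _ (eps / 2)%:E); last by rewrite lte_fin; lra.
apply: (@limn_esup_div_le R _ ((C + eps ^+ 2 / 2) / eps)) => N.
rewrite natr_sum big_mkcond/=.
apply: (@le_trans _ _ (\sum_(1 <= i < N.+1) u i / eps)).
  apply: ler_sum => i _; case: ifPn => [|_]; last by rewrite divr_ge0// ltW.
  by rewrite inE/= => ?; rewrite ler_pdivlMr// mul1r.
rewrite -mulr_suml ler_pdivrMr//; apply: le_trans (ler_sum_from1 _ u0) _.
apply: le_trans (bound x y xyd N.+1) _.
rewrite mulrDl divfK ?gt_eqF// -[N.+1%:R]natr1 le_eqVlt; apply/orP; left.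
by apply/eqP; lra.
Qed.

(** The orbit of a point that comes arbitrarily close to the orbit of a point
    of [K] at a common time stays close to it in the mean afterwards, and the
    times before do not affect averages. *)
Lemma mean_equicontinuous_attracted F K x : mean_equicontinuous (step F) ->
  (forall d : R, 0 < d -> exists m, exists2 z, K z &
    mdist (flow_iter F m x) (flow_iter F m z) < d) ->
  mean_attracted F K x.
Proof.
move=> TM near eps eps0; have [|C [d d0 bound]] := TM (eps / 2).
  by rewrite divr_gt0.
have [m [z Kz zd]] := near d d0; exists z => //.
pose u n := mdist (flow_iter F n x) (flow_iter F n z).
have u0 n : 0 <= u n by exact: mdist_ge0.
apply: (@le_lt_trans _ _ (eps / 2)%:E); last by rewrite lte_fin; lra.
under [X in limn_esup X]eq_fun do rewrite mulrC.
apply: (@limn_esup_div_le R _ (\sum_(i < m) u i + C + eps / 2)) => N.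
apply: le_trans (ler_sum_from1 _ u0) _.
apply: (@le_trans _ _ (\sum_(i < m + N.+1) u i)).
  by rewrite addnC big_split_ord/= lerDl sumr_ge0.
have := bound _ _ zd N.+1; rewrite big_split_ord/= -[N.+1%:R]natr1.
under eq_bigr do rewrite /flow_iter -!iterD addnC.
rewrite -/(flow_iter F); lra.
Qed.

End mean_equicontinuous_flows.

(** * Arcs on the circle *)

Section arcs.
Context {R : realType}.
Implicit Types (T : circle R -> circle R) (s t : R).

Lemma cisD1 t : cis (t + 1) = cis t.
Proof.
apply: val_inj => /=.
have -> : 2 * pi * (t + 1) = 2 * pi * t + pi *+ 2 by rewrite mulr2n; ring.
by rewrite (cosD (2 * pi * t)) (sinD (2 * pi * t)) cos2pi sin2pi !mulr1 !mulr0 subr0 addr0.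
Qed.

Lemma cisDint t (k : int) : cis (t + k%:~R) = cis t.
Proof.
have cisDnat (m : nat) s : cis (s + m%:R) = cis s.
  by elim: m => [|m IH]; rewrite ?addr0// -natr1 addrA cisD1.
case: k => m; first exact: cisDnat.
by rewrite NegzE mulrNz -(cisDnat m.+1) subrK.
Qed.

Lemma mdist_cis_le s t : mdist (cis s) (cis t) <= 2 * pi * `|s - t|.
Proof.
have [/cis_arc ->//|st] := leP `|s - t| 2^-1.
apply: (@le_trans _ _ pi).
  rewrite /mdist/= /arc_dist circle_inner acos_lepi// inner_itv// circle_eqn //.
by have := pi_gt0 R; nra.
Qed.

Lemma close_lifts (x y : circle R) : exists s t,
  [/\ cis s = x, cis t = y & `|s - t| <= 2^-1].
Proof.
have [s] := cis_surj x; have [t] := cis_surj y; rewrite !in_itv/=.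
move=> /andP[t0 t1] <- /andP[s0 s1] <-.
have [h|h] := leP (s - t) (- 2^-1).
  by exists (s + 1), t; split; rewrite ?cisD1// ler_norml; apply/andP; split; lra.
have [h'|h'] := leP (s - t) 2^-1.
  by exists s, t; split; rewrite // ler_norml; apply/andP; split; lra.
by exists s, (t + 1); split; rewrite ?cisD1// ler_norml; apply/andP; split; lra.
Qed.

Lemma cis_neq s t : s < t < s + 1 -> cis s <> cis t.
Proof.
move=> /andP[st ts1] E; have pi0 := pi_gt0 R.
suff [s' [t' [s't' E' s't'2]]] : exists s' t' : R,
    [/\ s' < t', cis s' = cis t' & `|s' - t'| <= 2^-1].
  have := cis_arc s't'2; rewrite E' mdistxx; have : 0 < `|s' - t'|.
    by rewrite normr_gt0 subr_eq0 lt_eqF.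
  by nra.
have [h|h] := leP (t - s) 2^-1.
  by exists s, t; split; rewrite // ler_norml; apply/andP; split; lra.
by exists t, (s + 1); split; rewrite ?cisD1// ler_norml; apply/andP; split; lra.
Qed.

Lemma iter_cis T (F : R -> R) : (forall t, T (cis t) = cis (F t)) ->
  forall n t, iter n T (cis t) = cis (iter n F t).
Proof. by move=> TF; elim=> //= n IH t; rewrite IH TF. Qed.

Lemma circle_mean_equicontinuous T (F : R -> R) : increasing_lift T F ->
  (forall m t (k : int), (0 < m)%N -> iter m F t <> t + k%:~R) ->
  mean_equicontinuous T.
Proof.
move=> [Fc Fi F1 TF] aper eta eta0; have pi0 := pi_gt0 R.
have pi2 : 0 < 2 * pi :> R by rewrite mulr_gt0.
have [|d d0 bound] := @short_arc_sum _ F Fc Fi F1 aper (eta / (2 * pi)).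
  by rewrite divr_gt0.
have C0 N : 0 <= 2 * pi * 2 + eta * N%:R by rewrite addr_ge0 ?mulr_ge0// ltW.
have lt_case s t N : s < t < s + d -> t <= s + 1 ->
    \sum_(i < N) mdist (iter i T (cis s)) (iter i T (cis t)) <=
    2 * pi * 2 + eta * N%:R.
  move=> std ts1; have := bound s t std ts1 N; rewrite -(ler_pM2l pi2).
  have -> : 2 * pi * (2 + eta / (2 * pi) * N%:R) = 2 * pi * 2 + eta * N%:R.
    by field; lra.
  apply: le_trans; rewrite mulr_sumr ler_sum// => i _.
  rewrite !(iter_cis TF); apply: le_trans (mdist_cis_le _ _) _.
  rewrite distrC ger0_norm// subr_ge0 iter_lift_mono//.
  by case/andP: std => /ltW.
exists (2 * pi * 2), (2 * pi * d); first by rewrite mulr_gt0.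
move=> x y + N; have [s [t [<- <- st2]]] := close_lifts x y.
rewrite (cis_arc st2) ltr_pM2l// => std.
move: st2 std; rewrite ler_norml ltr_norml => /andP[? ?] /andP[? ?].
have [st|ts|<-] := ltgtP s t.
- by apply: lt_case; [apply/andP; split|]; lra.
- under eq_bigr do rewrite metric_sym.
  by apply: lt_case; [apply/andP; split|]; lra.
- by rewrite big1// => i _; rewrite mdistxx.
Qed.

End arcs.

(** * Gaps of closed sets of reals *)

Lemma closed_greatest_below (R : realType) (A : set R) (u : R) : closed A ->
  (exists2 a, A a & a <= u) ->
  exists s, [/\ A s, s <= u & forall v, A v -> v <= u -> v <= s].
Proof.
move=> Acl [a Aa au].
have Kc : compact (A `&` `[a, u]).
  apply: (subclosed_compact _ (@segment_compact _ a u)); last by move=> ? [].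
  by apply: closedI => //; exact: interval_closed.
have K0 : A `&` `[a, u] !=set0 by exists a; split; rewrite //= in_itv/= lexx.
have [s sK smax] := @compact_EVT_max _ R id _ K0 Kc (continuous_subspaceT (fun=> cvg_id)).
move: sK; rewrite inE/= in_itv/= => -[As /andP[as_ su]].
exists s; split => // v Av vu; have [va|av] := leP v a; first exact: le_trans as_.
by apply: smax; rewrite inE; split; rewrite //= in_itv/= (ltW av).
Qed.

Lemma closed_gap (R : realType) (A : set R) (u : R) : closed A -> ~ A u ->
  (exists2 a, A a & a <= u) -> (exists2 b, A b & u <= b) ->
  exists s t, [/\ A s, A t, s < u < t & forall v, s < v < t -> ~ A v].
Proof.
move=> Acl Au below [b Ab ub].
have [s [As su smax]] := closed_greatest_below Acl below.
have NAcl : closed (-%R @^-1` A).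
  by apply: preimage_closed Acl => ? _; exact: opp_continuous.
have [|t [At tu tmax]] := @closed_greatest_below R (-%R @^-1` A) (- u) NAcl.
  by exists (- b); rewrite /= ?opprK// lerN2.
exists s, (- t); split => //.
  rewrite !lt_neqAle su lerNr tu !andbT; apply/andP; split.
    by apply/eqP => E; apply: Au; rewrite -E.
  by apply/eqP => E; apply: Au; rewrite E.
move=> v /andP[sv vt] Av; have [vu|uv] := leP v u.
  by have := smax v Av vu; rewrite leNgt sv.
have := tmax (- v); rewrite /= opprK => /(_ Av); rewrite lerN2 => /(_ (ltW uv)).
by lra.
Qed.

(** * The limit set of a Denjoy homeomorphism *)

Lemma lift_section (R : realType) (F : R -> R) : continuous F ->
  {homo F : s t / s < t} -> (forall t, F (t + 1) = F t + 1) ->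
  exists G, cancel G F.
Proof.
move=> Fc Fi F1; suff /choice[G GK] : forall u, exists v, F v = u by exists G.
move=> u; pose k := Num.floor (u - F 0).
have Fk (j : int) : F j%:~R = F 0 + j%:~R.
  by rewrite -(iter_lift_int F1 1 0 j)/= add0r.
have kk1 : k%:~R <= (k + 1)%:~R :> R by rewrite ler_int; lia.
have [|c _ <-] := @IVT R F k%:~R (k + 1)%:~R u kk1 (continuous_subspaceT Fc);
  last by exists c.
rewrite !Fk ge_min le_max; have := floor_le (u - F 0).
have := floorD1_gt (u - F 0); rewrite -/k => ? ?.
by apply/andP; split; apply/orP; [left|right]; lra.
Qed.

Section denjoy.
Context {R : realType} {T : circle R -> circle R} {L : set (circle R)}.
Hypothesis hT : denjoy_counterexample T L.

Lemma denjoy_lift : exists2 F, increasing_lift T F &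
  forall m t (k : int), (0 < m)%N -> iter m F t <> t + k%:~R.
Proof.
have [rho [F Flift Frho] irr] := denjoy_rotation hT.
exists F => //; case: Flift => _ _ F1 _; exact: irrational_no_periodic Frho irr.
Qed.

Lemma denjoy_mean_equicontinuous : mean_equicontinuous T.
Proof.
by have [F Flift aper] := denjoy_lift; exact: circle_mean_equicontinuous aper.
Qed.

(** An omega-limit set is also stable under the inverse map: a point close to
    [z] is the image of the previous point of the orbit, close to [S z]. *)
Lemma denjoy_inverse_stable S : continuous S -> cancel T S ->
  forall z, L z -> L (S z).
Proof.
move=> Sc TK z; rewrite -(denjoy_omega hT (cis 0)) => zL A B AT /Sc SB.
have [|w [/= Aw Bw]] := zL (S @^-1` A) (S @^-1` B) _ SB; last by exists (S w).
case: AT => N _ NA; exists N.+1 => // -[//|n] /= Nn.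
by rewrite TK; exact: NA.
Qed.

Lemma denjoy_minimal : minimal_subset (circle_flow (denjoy_homeo hT)) L.
Proof.
have [L0 _ [Lcl _] _] := denjoy_cantor hT.
split => //; first exact: denjoy_stable hT.
move=> x _ z Lz B Bz.
have zL : omega_limit T x z by rewrite (denjoy_omega hT).
apply: zL Bz; exists 0%N => // n _; exact/imageT.
Qed.

(** The orbit of any point comes arbitrarily close to [L], and the nearby point
    of [L] can be pulled back inside [L] to the initial time. *)
Lemma denjoy_attracted x : mean_attracted (circle_flow (denjoy_homeo hT)) L x.
Proof.
apply: mean_equicontinuous_attracted; first exact: denjoy_mean_equicontinuous.
move=> d d0; have [_ [S [Sc TK SK]]] := denjoy_homeo hT.
have [[w Lw] _ _ _] := denjoy_cantor hT.
have wx : omega_limit T x w by rewrite (denjoy_omega hT).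
have [||_ [[m _ <-] dm]] := wx (range (fun n => iter n T x)) (ball w d).
- by exists 0%N => // n _; exact/imageT.
- exact: nbhsx_ballx.
have iterK n : cancel (iter n S) (iter n T).
  by elim: n => [//|n IH] y; rewrite iterSr [iter _ S _]iterS SK IH.
exists m, (iter m S w).
  by elim: m {dm} => //= m IH; exact: denjoy_inverse_stable.
by rewrite /flow_iter/= iterK metric_sym; move: dm; rewrite ballEmdist.
Qed.

Lemma denjoy_limit_set_proper : exists u, ~ L (cis u).
Proof.
apply: contrapT => /forallNP Lall.
have LT : L = setT.
  apply/seteqP; split => // z _; have [t _ <-] := cis_surj z.
  exact: contrapT (Lall t).
have [_ _ _ Ldis] := denjoy_cantor hT.
have conn : connected (range (@cis R)).
  apply: connected_continuous_connected; last exact/continuous_subspaceT/cis_continuous.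
  by apply/connected_intervalP.
have L0 : L (cis 0) by rewrite LT.
apply: (@cis_neq R 0 2^-1); first by apply/andP; split; lra.
suff : connected_component L (cis 0) (cis 2^-1) by rewrite Ldis// => ->.
apply: connected_component_max conn _ _; [exact/imageT|by rewrite LT|exact/imageT].
Qed.

(** A gap of [L] is an arc whose backward iterates are gaps of [L] that are
    pairwise distinct, as [T] has no periodic point, hence pairwise disjoint:
    their lengths tend to zero. So there are points of [L] arbitrarily close to
    each other that the iterates of [T] map to the two ends of the first gap. *)
Lemma denjoy_not_equicontinuous : ~ equicontinuous_flow (denjoy_flow hT).
Proof.
have [F [Fc Fi F1 TF] aper] := denjoy_lift.
have [_ [S [Sc TK SK]]] := denjoy_homeo hT.
have [G GK] := lift_section Fc Fi F1.
pose A := @cis R @^-1` L.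
have AD t (k : int) : A (t + k%:~R) <-> A t by rewrite /A /preimage/= cisDint.
have AF n t : A t -> A (iter n F t).
  rewrite /A/= -(iter_cis TF); elim: n => //= n IH tA.
  exact/(denjoy_stable hT)/IH.
have AG n t : A t -> A (iter n G t).
  move=> tA; elim: n => //= n; rewrite /A/= -{1}(GK (iter n G t)) -TF.
  by move=> /(denjoy_inverse_stable Sc TK); rewrite TK.
have GnK n : cancel (iter n G) (iter n F).
  by elim: n => [//|n IH] y; rewrite iterSr [iter _ G _]iterS GK IH.
have Acl : closed A.
  have [_ _ [Lcl _] _] := denjoy_cantor hT.
  by apply: preimage_closed Lcl => ? _; exact: cis_continuous.
have [u Au] := denjoy_limit_set_proper.
have [a Aa] : exists a, A a.
  have [[z Lz] _ _ _] := denjoy_cantor hT.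
  by have [a _ az] := cis_surj z; exists a; rewrite /A/= az.
have [||s [t [As At /andP[su ut] gap]]] := closed_gap Acl Au.
- exists (a + (Num.floor (u - a))%:~R); first exact/AD.
  by have := floor_le (u - a); lra.
- exists (a + (Num.floor (u - a) + 1)%:~R); first exact/AD.
  by have := floorD1_gt (u - a); lra.
have st : s < t := lt_trans su ut.
pose sn n := iter n G s; pose tn n := iter n G t.
have Gmono n x y : (iter n G x < iter n G y) = (x < y).
  by rewrite -(leW_mono (iter_lift_mono Fi n)) !GnK.
have gapn n v : sn n < v < tn n -> ~ A v.
  move=> vI /(AF n); apply: gap.
  by rewrite -(GnK n s) -(GnK n t) !(leW_mono (iter_lift_mono Fi n)).
have sum2 N : \sum_(i < N) (tn i - sn i) <= 2.
  apply: arc_packing => [i _|i j /andP[ij _] k].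
    rewrite Gmono st leNgt; apply/negP => st1; apply: (@gapn i (sn i + 1)).
      by apply/andP; split; lra.
    by apply/(AD _ 1)/AG.
  have [lt_ij|lt_ji|eq_ij] := ltgtP (sn i) (sn j + k%:~R).
  - right; rewrite leNgt; apply/negP => h.
    by apply: (@gapn i (sn j + k%:~R)); [rewrite lt_ij|exact/AD/AG].
  - left; rewrite leNgt; apply/negP => h.
    apply: (@gapn j (sn i - k%:~R)); first by apply/andP; split; lra.
    by rewrite -mulrNz; apply/AD/AG.
  - exfalso; apply: (@aper (j - i)%N s k); first by rewrite subn_gt0.
    have /(congr1 (iter j F)) := eq_ij; rewrite iter_lift_int// [RHS]/= GnK.
    by rewrite -[X in iter X](subnK (ltnW ij)) iterD GnK.
(* [F s] is not congruent to [s] modulo 1, so one of its translates lies in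
   ]s, s + 1[; it belongs to [A], so the gap is shorter than a full turn *)
have neq : cis s <> cis t.
  pose k := Num.floor (F s - s).
  have Fs : F s - s <> k%:~R.
    by move=> E; apply: (@aper 1%N s k) => //=; rewrite -E addrC subrK.
  have k1 : k%:~R < F s - s by rewrite lt_neqAle floor_le andbT; apply/eqP => /esym.
  have k2 := floorD1_gt (F s - s); rewrite intrD -/k in k2.
  apply: cis_neq; rewrite st/= ltNge; apply/negP => ts1.
  apply: (@gap (F s + (- k)%:~R)); first by rewrite mulrNz; apply/andP; split; lra.
  by apply/AD; exact: (AF 1%N).
move=> eqc; have st0 : 0 < mdist (cis s) (cis t) by rewrite mdist_gt0; apply/eqP.
have [d d0 near] := eqc _ st0; have pi0 := pi_gt0 R.
have d2 : 0 < d / (2 * pi) by rewrite divr_gt0// mulr_gt0.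
have [n small] : exists n, tn n - sn n < d / (2 * pi).
  apply: contrapT => /forallNP big.
  pose N := (Num.truncn (2 / (d / (2 * pi)))).+1.
  have := sum2 N; apply/negP; rewrite -ltNge.
  apply: (@lt_le_trans _ _ (\sum_(i < N) d / (2 * pi))).
    by rewrite sumr_const card_ord -[_ *+ N]mulr_natl -ltr_pdivrMr// truncnS_gt.
  by apply: ler_sum => i _; rewrite leNgt; apply/negP; exact: big.
have := near (cis (sn n)) (cis (tn n)) (AG n s As) (AG n t At) _ n.
rewrite /flow_iter/= !(iter_cis TF) !GnK ltxx => H; suff: false by []; apply: H.
apply: le_lt_trans (mdist_cis_le _ _) _.
rewrite distrC gtr0_norm ?subr_gt0 ?Gmono//.
by rewrite mulrC -ltr_pdivlMr// mulr_gt0.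
Qed.

End denjoy.

(** * The theorem *)

Theorem theorem8 (R : realType) (T : circle R -> circle R) (L : set (circle R))
    (hT : denjoy_counterexample T L) :
  [/\ MMA (circle_flow (denjoy_homeo hT)),
      ~ equicontinuous_flow (denjoy_flow hT),
      MLS (denjoy_flow hT) &
      MMLS (circle_flow (denjoy_homeo hT))].
Proof.
have meq := denjoy_mean_equicontinuous hT; split.
- apply/seteqP; split => // x _; exists L; first exact: denjoy_minimal.
  by split => //; exact: denjoy_attracted.
- exact: denjoy_not_equicontinuous.
- exact: mean_equicontinuous_MLS.
- by move=> K mK; exact: mean_equicontinuous_MLS.
Qed.
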